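(* Let $M$ be an antidiagonalizable complex matrix of size $n$. If $n$ is even, then $M$ has a symmetric spectrum. If $n$ is odd, then $M$ has a c-symmetric spectrum, and in this case $M$ has a symmetric spectrum if and only if $M$ is traceless. In particular, if $M$ is similar to an antidiagonal matrix $A$ in standard form with entries $a_1,\dots,a_n$, then $\mathrm{spec}(M)=\mathrm{spec}(A)$, $\det M=\det A$ and $\mathrm{tr}(M)=\mathrm{tr}(A)$, where, as a multiset, $\mathrm{spec}(A)=\{\pm\sqrt{a_1}\sqrt{a_2},\dots,\pm\sqrt{a_{n-1}}\sqrt{a_n}\}$ for $n$ even and $\mathrm{spec}(A)=\{a_1,\pm\sqrt{a_2}\sqrt{a_3},\dots,\pm\sqrt{a_{n-1}}\sqrt{a_n}\}$ for $n$ odd; $\det A=(-1)^{\lfloor n/2\rfloor}a_1\cdots a_n$; and $\mathrm{tr}(A)=0$ for $n$ even, $\mathrm{tr}(A)=a_1$ for $n$ odd.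
   Context: A matrix is antidiagonal if its only nonzero entries are at positions $(i,n+1-i)$, and antidiagonalizable if it is similar to an antidiagonal matrix. Standard form of an antidiagonal matrix: for $n=2m$, $A_{m+1-j,\,m+j}=a_{2j-1}$ and $A_{m+j,\,m+1-j}=a_{2j}$ for $1\le j\le m$; for $n=2m+1$, $A_{m+1,m+1}=a_1$, $A_{m+1-j,\,m+1+j}=a_{2j+1}$ and $A_{m+1+j,\,m+1-j}=a_{2j}$ for $1\le j\le m$. $\sqrt{a_k}$ is a fixed complex square root. The spectrum is the multiset of eigenvalues with algebraic multiplicity. $M$ has a symmetric spectrum if for every eigenvalue $\lambda$ of algebraic multiplicity $l$, $-\lambda$ is also an eigenvalue of algebraic multiplicity $l$. A matrix of odd size with spectrum $\mathcal S$ has a c-symmetric spectrum if there is $c\in\mathcal S$ such that the multiset $\mathcal S\setminus\{c\}$ (one copy of $c$ removed) is invariant under multiplication by $-1$. *)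

(* Defs.v *)
From HB Require Import structures.
From mathcomp Require Import all_boot all_order all_algebra.
From mathcomp Require Import finmap multiset complex reals.

Set Implicit Arguments.
Unset Strict Implicit.
Unset Printing Implicit Defensive.

Import GRing.Theory.
Local Open Scope ring_scope.
Local Open Scope mset_scope.

Definition is_antidiag_mx (C : fieldType) n (A : 'M[C]_n) : bool :=
  [forall i, forall j, (j != rev_ord i) ==> (A i j == 0)].

Definition antidiagonalizable (C : fieldType) n (M : 'M[C]_n) : Prop :=
  similar_in_to unitmx M (@is_antidiag_mx C n).

(* The entry at row i and column j, with rows and columns numbered from 1.
   The value outside 1 <= i, j <= n is irrelevant. *)
Definition entry1 (C : fieldType) n (A : 'M[C]_n) (i j : nat) : C :=
  match insub i.-1 : option 'I_n, insub j.-1 : option 'I_n with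
  | Some r, Some c => A r c
  | _, _ => 0
  end.

(* The entries of the standard form are a 1, ..., a n; the other values of a
   play no role. *)
Definition standard_form (C : fieldType) n (a : nat -> C) (A : 'M[C]_n) : Prop :=
  let m := n./2 in
  is_antidiag_mx A /\
  if odd n then
    entry1 A m.+1 m.+1 = a 1%N /\
    forall j, (1 <= j <= m)%N ->
      entry1 A (m.+1 - j) (m.+1 + j) = a (2 * j + 1)%N /\
      entry1 A (m.+1 + j) (m.+1 - j) = a (2 * j)%N
  else
    forall j, (1 <= j <= m)%N ->
      entry1 A (m.+1 - j) (m + j) = a (2 * j - 1)%N /\
      entry1 A (m + j) (m.+1 - j) = a (2 * j)%N.

Definition alg_mult (C : fieldType) n (M : 'M[C]_n) (x : C) : nat :=
  mup x (char_poly M).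

(* The roots of the characteristic polynomial, repeated according to their
   multiplicity; see specE. *)
Definition spec (C : closedFieldType) n (M : 'M[C]_n) : {mset C} :=
  seq_mset (sval (closed_field_poly_normal (char_poly M))).

Lemma specE (C : closedFieldType) n (M : 'M[C]_n) x : spec M x = alg_mult M x.
Proof.
rewrite /spec mset_seqE /alg_mult.
case: closed_field_poly_normal => r /=.
rewrite (monicP (char_poly_monic M)) scale1r => ->.
elim: r => [|y r IHr]; first by rewrite big_nil mupNroot // root1.
rewrite big_cons mupM ?polyXsubC_eq0 //; last first.
  by rewrite monic_neq0 // monic_prod_XsubC.
by rewrite -IHr -['X - y%:P]expr1 mup_XsubCX /=; case: eqP.
Qed.

Definition symmetric_spectrum (C : closedFieldType) n (M : 'M[C]_n) : Prop :=
  forall x, eigenvalue M x ->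
    eigenvalue M (- x) /\ alg_mult M (- x) = alg_mult M x.

Definition mset_opp (C : closedFieldType) (S : {mset C}) : {mset C} :=
  seq_mset [seq - x | x <- S].

Definition c_symmetric_spectrum (C : closedFieldType) n (M : 'M[C]_n) : Prop :=
  exists2 c, c \in spec M & mset_opp (spec M `\ c) = spec M `\ c.

(* The multiset given in closed form for a standard form with entries
   a 1, ..., a n, where s k is a square root of a k. *)
Definition standard_spec (C : closedFieldType) n (a s : nat -> C) : {mset C} :=
  let pm k := [:: s k * s k.+1; - (s k * s k.+1)] in
  seq_mset
    (if odd n then a 1%N :: flatten [seq pm (2 * j)%N | j <- iota 1 n./2]
     else flatten [seq pm (2 * j - 1)%N | j <- iota 1 n./2]).

(* Main.v *)
(** The characteristic matrix of an antidiagonal matrix vanishes on its outer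
    rows except at the four corners, so its determinant is the determinant of
    the corners times that of the inner block.  By induction from the outside
    inwards, the characteristic polynomial is the product of the factors
    [X^2 - b c], where [b] and [c] are opposite antidiagonal entries, and of
    [X - a] for the central entry [a] when the size is odd. *)

Require Import Defs.
From mathcomp Require Import all_boot all_order all_algebra.
From mathcomp Require Import complex reals.
From mathcomp Require Import finmap multiset.
From mathcomp Require Import zify ring.

Import GRing.Theory Num.Def Num.Theory.
Local Open Scope ring_scope.

(** Laplace expansion along the first row leaves two minors, and the last row of each is zero except
    for one corner. Expanding again along that row leaves the inner block in both cases. *)
Lemma det_corners {R : comNzRingType} {n : nat} (A : 'M[R]_n.+2) :
    (forall j, j != ord0 -> j != ord_max -> A ord0 j = 0) ->
    (forall j, j != ord0 -> j != ord_max -> A ord_max j = 0) ->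
  let inner (i : 'I_n) : 'I_n.+2 := lift ord0 (lift ord_max i) in
  \det A = (A ord0 ord0 * A ord_max ord_max - A ord0 ord_max * A ord_max ord0)
             * \det (mxsub inner inner A).
Proof.
move=> A0 Am inner.
have maxE : lift ord0 ord_max = ord_max :> 'I_n.+2 by apply: val_inj.
have lmax0 : lift ord_max ord0 = ord0 :> 'I_n.+2 by apply: val_inj.
have lmaxS (i : 'I_n) : lift ord_max (lift ord0 i) = inner i.
  by apply: val_inj; rewrite /= /bump /= !add1n ltnS; case: i => i /= /[dup]; lia.
have inner0 i : inner i != ord0 by [].
have innerm i : inner i != ord_max.
  by rewrite -val_eqE /= /bump /=; case: i => i /=; lia.
have wl (i : 'I_n) : lift ord0 (widen_ord (leqnSn n) i) = inner i.
  by apply: val_inj; rewrite /= /bump /=; case: i => i /=; lia.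
rewrite (expand_det_row A ord0) big_ord_recl big_ord_recr /= big1 ?add0r => [|i _].
  rewrite maxE /cofactor /= addn0 expr0 mul1r add0n.
  rewrite (expand_det_row (row' ord0 (col' ord0 A)) ord_max).
  rewrite big_ord_recr big1 ?add0r; last first.
    by move=> i _; rewrite !mxE maxE wl Am ?mul0r.
  rewrite (expand_det_row (row' ord0 (col' ord_max A)) ord_max).
  rewrite big_ord_recl big1 ?addr0; last first.
    by move=> i _; rewrite !mxE maxE lmaxS Am ?mul0r.
  rewrite !mxE maxE lmax0 /cofactor /= addn0 addnn -signr_odd odd_double expr0 mul1r.
  have -> : row' (ord_max : 'I_n.+1) (col' ord_max (row' ord0 (col' ord0 A))) =
            mxsub inner inner A by apply/matrixP => i j; rewrite !mxE.
  have -> : row' (ord_max : 'I_n.+1) (col' ord0 (row' ord0 (col' ord_max A))) =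
            mxsub inner inner A by apply/matrixP => i j; rewrite !mxE lmaxS.
  (* The sign of the crossed corners: the first expansion uses position (0, n+1), the second
     position (n, 0) of a minor. *)
  have sgn : (-1) ^+ n.+1 * (-1) ^+ n = -1 :> R.
    by rewrite -exprD addSn addnn -signr_odd /= odd_double.
  set d := \det _.
  transitivity (A ord0 ord0 * A ord_max ord_max * d +
    A ord0 ord_max * A ord_max ord0 * ((-1) ^+ n.+1 * (-1) ^+ n) * d); first by ring.
  by rewrite sgn; ring.
by rewrite wl A0 ?mul0r.
Qed.

(** With [f] defined on all of [nat], passing to the inner block is just the shift [f \o S]; a
    general ring leaves room for polynomial entries. *)
Definition antidiag_mx {R : nzRingType} (n : nat) (f : nat -> R) : 'M[R]_n :=
  \matrix_(i, j) (f i *+ ((i + j).+1 == n)).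

(* Rows are numbered from 0: [n./2 - j] and [(uphalf n + j).-1] are the rows at
   distance [j] from the centre, exchanged by [i |-> n.-1 - i]. *)
Lemma det_scalar_antidiag {R : comNzRingType} (n : nat) (f : nat -> R) (x : R) :
  \det (x%:M + antidiag_mx n f) =
    (if odd n then x + f n./2 else 1) *
    \prod_(1 <= j < n./2.+1) (x ^+ 2 - f (n./2 - j)%N * f (uphalf n + j).-1).
Proof.
have [m] := ubnP n; elim: m n f => // m IHm [|[|n]] f ltnm.
- by rewrite det_mx00 big_geq // mulr1.
- by rewrite det_mx11 !mxE /= big_geq // mulr1.
rewrite det_corners; first last.
- move=> j; rewrite -!val_eqE !mxE /= -val_eqE /= => j0 jm.
  rewrite eq_sym (negPf jm) eqn_leq; case: (nat_of_ord j) j0 => // k _.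
  by rewrite addnS ltnNge leq_addr /= !mulr0n addr0.
- move=> j; rewrite -!val_eqE !mxE /= -val_eqE /= => j0 jm.
  by rewrite add0n eqSS eq_sym (negPf j0) (negPf jm) !mulr0n addr0.
rewrite (_ : mxsub _ _ _ = x%:M + antidiag_mx n (f \o S)); last first.
  apply/matrixP => i j; rewrite !mxE -!val_eqE /= /bump /=.
  rewrite (leqNgt n i) (leqNgt n j) !ltn_ord /= !add0n !add1n !eqSS.
  by rewrite -[X in f _ *+ (X == n)]/(i + j.+1)%N addnS.
rewrite IHm; last by lia.
rewrite !mxE -!val_eqE /= !add0n !addn0 !eqSS !eqxx /=.
rewrite -[X in f _ *+ (X == n)]/(n + n.+1)%N (_ : (n + n.+1 == n)%N = false); last by lia.
(* Factors are counted from the centre, so the four corners give the last one, at [j = n./2.+1], and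
   the inner factors keep their index. *)
rewrite [in RHS]big_nat_recr //= subnn negbK.
rewrite (_ : (uphalf n + n./2.+1 = n.+1)%N); last by lia.
have -> : \prod_(1 <= j < n./2.+1) (x ^+ 2 - f (n./2 - j).+1 * f (uphalf n + j).-1.+1) =
  \prod_(1 <= j < n./2.+1) (x ^+ 2 - f (n./2.+1 - j)%N * f (uphalf n + j)%N).
  apply: eq_big_nat => j /andP[j_gt0 j_le].
  by rewrite subSn // prednK // addn_gt0 j_gt0 orbT.
by rewrite !mulr0n !mulr1n; ring.
Qed.

Lemma trace_antidiag {R : nzRingType} (n : nat) (f : nat -> R) :
  \tr (antidiag_mx n f) = if odd n then f n./2 else 0.
Proof.
rewrite /mxtrace; case: ifP => n_odd; last first.
  by rewrite big1 // => i _; rewrite mxE [_ == _](_ : _ = false) //; lia.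
have lt_n2 : (n./2 < n)%N by lia.
rewrite (bigD1 (Ordinal lt_n2)) //= mxE /= [_ == _](_ : _ = true); last by lia.
rewrite big1 ?addr0 // => i; rewrite mxE -val_eqE /= => ne_i.
by rewrite [_ == _](_ : _ = false) //; lia.
Qed.

Lemma det_antidiag {R : comNzRingType} (n : nat) (f : nat -> R) :
  \det (antidiag_mx n f) =
    (-1) ^+ n./2 * ((if odd n then f n./2 else 1) *
    \prod_(1 <= j < n./2.+1) (f (n./2 - j)%N * f (uphalf n + j).-1)).
Proof.
have -> : antidiag_mx n f = 0%:M + antidiag_mx n f by rewrite raddf0 add0r.
rewrite det_scalar_antidiag add0r mulrCA.
congr (_ * _); rewrite (eq_bigr (fun j => -1 * (f (n./2 - j)%N * f (uphalf n + j).-1))).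
  by rewrite big_split /= big_const_nat subn1 /= -Monoid.iteropE.
by move=> j _; rewrite expr2 mul0r sub0r mulN1r.
Qed.

(** This is [det_scalar_antidiag] over polynomials at ['X], with [f] negated; the two signs cancel
    within each pair. *)
Lemma char_poly_antidiag {R : comNzRingType} (n : nat) (f : nat -> R) :
  char_poly (antidiag_mx n f) =
    (if odd n then 'X - (f n./2)%:P else 1) *
    \prod_(1 <= j < n./2.+1) ('X^2 - (f (n./2 - j)%N * f (uphalf n + j).-1)%:P).
Proof.
rewrite /char_poly /char_poly_mx.
have -> : - map_mx polyC (antidiag_mx n f) = antidiag_mx n (fun i => - (f i)%:P).
  by apply/matrixP => i j; rewrite !mxE rmorphMn /= mulNrn.
rewrite det_scalar_antidiag; congr (_ * _); apply: eq_bigr => j _.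
by rewrite mulrNN -polyCM.
Qed.

Lemma antidiag_mxE {C : fieldType} {n : nat} (A : 'M[C]_n) :
  is_antidiag_mx A -> A = antidiag_mx n (fun i => entry1 A i.+1 (n - i)).
Proof.
move=> /forallP A_anti; apply/matrixP => i j; rewrite mxE.
have /forallP/(_ j)/implyP := A_anti i; case: (j =P rev_ord i) => [->|ne_j /(_ isT)/eqP->].
  rewrite /= (_ : (i + (n - i.+1)).+1 == n); last by case: i => i /=; lia.
  by rewrite /entry1 /= -subnS valK (valK (rev_ord i)).
rewrite [_ == _](_ : _ = false) //; apply: contra_notF ne_j => /eqP ij.
by apply: val_inj; rewrite /=; lia.
Qed.

Lemma spec_eq {C : closedFieldType} {n : nat} (M : 'M[C]_n) (r : seq C) :
  char_poly M = \prod_(z <- r) ('X - z%:P) -> spec M = seq_mset r.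
Proof.
move=> char_M; rewrite /spec; case: closed_field_poly_normal => t /=.
rewrite (monicP (char_poly_monic M)) scale1r char_M => /prod_XsubC_eq.
by rewrite perm_sym => /eq_seq_msetP.
Qed.

(** Each quadratic factor splits as (X - z)(X + z). Leaving the choice of [z] free serves both
    [sqrtC] and the products of the given roots of the entries. *)
Lemma spec_antidiag {C : closedFieldType} (n : nat) (f z : nat -> C) :
    (forall j, (1 <= j <= n./2)%N ->
       z j ^+ 2 = f (n./2 - j)%N * f (uphalf n + j).-1) ->
  spec (antidiag_mx n f) =
    seq_mset ((if odd n then [:: f n./2] else [::]) ++
              flatten [seq [:: z j; - z j] | j <- iota 1 n./2]).
Proof.
move=> zE; apply: spec_eq; rewrite char_poly_antidiag big_cat; congr (_ * _).
  by case: odd; rewrite ?big_seq1 ?big_nil.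
rewrite big_flatten big_map (_ : iota 1 n./2 = index_iota 1 n./2.+1); last first.
  by rewrite /index_iota subn1.
apply: eq_big_nat => j; rewrite ltnS => /zE <-.
by rewrite big_cons big_seq1 polyCN polyC_exp subr_sqr opprK.
Qed.

(** Passes from rows numbered from 1 to rows numbered from 0. Below the centre, [uphalf n] skips the
    central row exactly when [n] is odd, so one formula covers both parities. *)
Lemma standard_form_antidiag {C : fieldType} {n : nat} {a : nat -> C} {A : 'M[C]_n} :
    standard_form a A ->
  exists2 f, A = antidiag_mx n f &
    (odd n -> f n./2 = a 1%N) /\
    (forall j, (1 <= j <= n./2)%N ->
       f (n./2 - j)%N = a (if odd n then 2 * j + 1 else 2 * j - 1)%N /\
       f (uphalf n + j).-1 = a (2 * j)%N).
Proof.
move=> [/antidiag_mxE AE std]; eexists; first exact: AE; split=> [n_odd|j lej].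
  by move: std; rewrite n_odd => -[<- _]; congr entry1; lia.
move: std; case: ifP => n_odd.
  move=> [_ /(_ j lej)[<- <-]]; split; congr entry1; lia.
move=> /(_ j lej)[<- <-]; split; congr entry1; lia.
Qed.

Lemma count_flatten_opp {V : zmodType} (z : nat -> V) (x : V) (r : seq nat) :
  let L := flatten [seq [:: z j; - z j] | j <- r] in
  count_mem (- x) L = count_mem x L.
Proof.
by elim: r => //= j r ->; rewrite eqr_opp eqr_oppLR addnCA.
Qed.

(** The relation PM = AP extends to the characteristic matrices, since scalar matrices commute with
    P; taking determinants, det P cancels. *)
Lemma similar_invariants {C : fieldType} {n : nat} {M A : 'M[C]_n} :
  similar_in unitmx M A ->
  [/\ char_poly M = char_poly A, \det M = \det A & \tr M = \tr A].
Proof.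
move=> [P P_unit simP]; have PM := similarP P_unit simP.
have detP : \det P != 0 by rewrite -unitfE -unitmxE.
split; last by rewrite (similarRL P_unit simP) mxtrace_mulC mulKmx.
  have charP : map_mx polyC P *m char_poly_mx M = char_poly_mx A *m map_mx polyC P.
    by rewrite mulmxBr mulmxBl -!map_mxM PM scalar_mxC.
  have := congr1 determinant charP; rewrite !det_mulmx det_map_mx mulrC.
  by apply: mulIf; rewrite polyC_eq0.
by have := congr1 determinant PM; rewrite !det_mulmx mulrC => /(mulIf detP).
Qed.

Lemma symmetric_spectrumP {C : closedFieldType} {n : nat} (M : 'M[C]_n) :
  symmetric_spectrum M <-> (forall x, spec M (- x) = spec M x).
Proof.
have eigenE x : eigenvalue M x = (0 < spec M x)%N.
  rewrite eigenvalue_root_char specE /alg_mult -XsubC_dvd ?dvdp_XsubCl //.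
  by rewrite monic_neq0 ?char_poly_monic.
split=> symM x; last by rewrite !eigenE -!specE symM.
have [/symM[_]|] := boolP (eigenvalue M x); first by rewrite -!specE.
(* When only [- x] is known to be an eigenvalue, symmetry is applied there; when neither is, both
   multiplicities are 0. *)
have [/symM[]|] := boolP (eigenvalue M (- x)); first by rewrite opprK => ->.
by rewrite !eigenE -!eqn0Ngt => /eqP-> /eqP->.
Qed.

Lemma mset_oppE {C : closedFieldType} (S : {mset C}%mset) (x : C) : mset_opp S x = S (- x).
Proof.
rewrite /mset_opp mset_seqE count_map -count_mem_mset.
by apply: eq_count => y /=; rewrite eqr_oppLR.
Qed.

(** [L] collects the pairs of opposite roots. In odd size the one remaining eigenvalue is the
    central entry, which is the trace of the antidiagonal form and hence of [M]. *)
Lemma antidiagonalizable_spectrum {C : numClosedFieldType} {n : nat} (M : 'M[C]_n) :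
    antidiagonalizable M ->
  exists L, (forall x, count_mem (- x) L = count_mem x L) /\
    spec M = seq_mset (if odd n then \tr M :: L else L).
Proof.
move=> [P P_unit] /antidiag_mxE; set f := (fun i => _) => PM.
have [charM _ trM] : [/\ char_poly M = char_poly (antidiag_mx n f),
    \det M = \det (antidiag_mx n f) & \tr M = \tr (antidiag_mx n f)].
  by apply: similar_invariants; exists P => //; apply/eqP.
pose z j := sqrtC (f (n./2 - j)%N * f (uphalf n + j).-1).
exists (flatten [seq [:: z j; - z j] | j <- iota 1 n./2]).
split=> [x|]; first exact: count_flatten_opp.
rewrite /spec charM -/(spec _) (spec_antidiag n f z) => [|j _]; last exact: sqrtCK.
by rewrite trM trace_antidiag; case: odd.
Qed.

(** Groups the labels as the standard form places them on opposite entries; induction by steps of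
    two preserves the parity that fixes the pairing. *)
Lemma prod_nat_pairs {R : comNzRingType} (n : nat) (a : nat -> R) :
  \prod_(1 <= k < n.+1) a k =
    (if odd n then a 1%N else 1) *
    \prod_(1 <= j < n./2.+1) (a (if odd n then 2 * j + 1 else 2 * j - 1)%N * a (2 * j)%N).
Proof.
have [m] := ubnP n; elim: m n => // m IHm [|[|n]] ltnm.
- by rewrite !big_geq // mulr1.
- by rewrite big_nat1 [in RHS]big_geq ?mulr1.
rewrite [in RHS]big_nat_recr // 2?[in LHS]big_nat_recr //= IHm; last by lia.
rewrite negbK; case: ifP => n_odd; rewrite -?mulrA; congr (_ * _); congr (_ * _).
  by rewrite mulrC; congr (a _ * a _); lia.
by congr (a _ * a _); lia.
Qed.

Theorem corollary5p4 (R : realType) (n : nat) (M : 'M[R[i]]_n) :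
  (antidiagonalizable M ->
     (~~ odd n -> symmetric_spectrum M) /\
     (odd n -> c_symmetric_spectrum M /\
               (symmetric_spectrum M <-> \tr M = 0))) /\
  (forall (A : 'M[R[i]]_n) (a s : nat -> R[i]),
     similar_in unitmx M A ->
     standard_form a A ->
     (forall k, (1 <= k <= n)%N -> s k ^+ 2 = a k) ->
     [/\ spec M = spec A, \det M = \det A & \tr M = \tr A] /\
     [/\ spec A = standard_spec n a s,
         \det A = (-1) ^+ n./2 * \prod_(1 <= k < n.+1) a k
       & \tr A = if odd n then a 1%N else 0]).
Proof.
split=> [/antidiagonalizable_spectrum[L [symL specM]]|A a s simM stdA sE].
  split=> [/negbTE n_even|n_odd].
    by apply/symmetric_spectrumP => x; rewrite specM n_even !mset_seqE symL.
  rewrite n_odd in specM.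
  have multM x : spec M x = ((x == \tr M) + count_mem x L)%N.
    by rewrite specM mset_seqE /= eq_sym.
  split.
    exists (\tr M); first by rewrite in_mset multM eqxx.
    by apply/msetP => x; rewrite mset_oppE !msetB1E !multM !addKn symL.
  (* Comparing multiplicities at t = tr M and at -t, the contributions of [L] cancel, which forces
     -t = t and so t = 0. *)
  split=> [/symmetric_spectrumP/(_ (\tr M))|trM0].
    rewrite !multM symL eqxx => /addIn; case: eqP => // trN _.
    by apply/eqP; rewrite -eqNr trN.
  by apply/symmetric_spectrumP => x; rewrite !multM symL trM0 oppr_eq0.
have [charM detM trM] := similar_invariants simM.
split; first by split; [rewrite /spec charM | exact: detM | exact: trM].
have [f -> [fc fE]] := standard_form_antidiag stdA.
split.
- pose z j := (if odd n then s (2 * j)%N * s (2 * j).+1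
                 else s (2 * j - 1)%N * s (2 * j - 1).+1).
  rewrite (spec_antidiag n f z) => [|j lej].
    by rewrite /standard_spec /z; case: ifP => [/fc->|].
  have [-> ->] := fE j lej; rewrite /z; case: ifP => n_odd; rewrite exprMn !sE; try lia.
    by rewrite mulrC addn1.
  (* The truncated subtraction is harmless: [(2 * j - 1).+1 = 2 * j] because [j] is at least 1. *)
  by congr (_ * a _); lia.
- rewrite det_antidiag (prod_nat_pairs n a); congr (_ * (_ * _)).
    by case: ifP => // /fc.
  by apply: eq_big_nat => j; rewrite ltnS => /fE[-> ->].
by rewrite trace_antidiag; case: ifP => // /fc.
Qed.
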